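(* Let $X$ be an arbitrary set. Then $$\mathcal F_X = E(\mathcal{PB}_X)\,\mathcal G_X = \mathcal G_X\, E(\mathcal{PB}_X) = \{\alpha\in\mathcal{PB}_X : \operatorname{def}(\alpha)=\operatorname{codef}(\alpha)\}.$$
   Context: Partial Brauer monoid. Let $X$ be a set and $X'=\{x':x\in X\}$ a disjoint copy of $X$. A Brauer graph is an (undirected) graph with vertex set $X\cup X'$ in which every vertex has degree at most $1$; $\mathcal{PB}_X$ is the set of all of them. Product: let $X''=\{x'':x\in X\}$ be another disjoint copy of $X$; given $\alpha,\beta\in\mathcal{PB}_X$, let $\alpha^\vee$ be $\alpha$ with each vertex $x'$ renamed $x''$, let $\beta^\wedge$ be $\beta$ with each vertex $x\in X$ renamed $x''$, and let $\Pi(\alpha,\beta)$ be the graph on $X\cup X'\cup X''$ with all edges of $\alpha^\vee$ and $\beta^\wedge$. Then $\alpha\beta$ is the graph on $X\cup X'$ with an edge $\{x,y\}$ whenever $x,y\in X\cup X'$ are distinct and lie in the same connected component of $\Pi(\alpha,\beta)$. This makes $\mathcal{PB}_X$ a monoid with identity the graph with edge set $\{\{x,x'\}:x\in X\}$. A transversal of $\alpha$ is an edge $\{x,y'\}$ with $x,y\in X$ (possibly $x=y$). $\operatorname{Dom}(\alpha)$ is the set of $x\in X$ such that $x$ belongs to a transversal of $\alpha$; $\operatorname{Codom}(\alpha)$ is the set of $x\in X$ such that $x'$ belongs to a transversal; $\operatorname{def}(\alpha)=|X\setminus\operatorname{Dom}(\alpha)|$ and $\operatorname{codef}(\alpha)=|X\setminus\operatorname{Codom}(\alpha)|$.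 $E(\mathcal{PB}_X)$ is the set of all idempotents of $\mathcal{PB}_X$; $\mathcal G_X$ is the group of (two-sided) units of $\mathcal{PB}_X$; $\mathcal F_X=\langle E(\mathcal{PB}_X)\cup\mathcal G_X\rangle$ is the subsemigroup generated by all idempotents and units. For subsets $A,B$ of a semigroup, $AB=\{ab:a\in A,\ b\in B\}$. *)

(* Defs.v *)
From HB Require Import structures.
From mathcomp Require Import all_boot.
From mathcomp Require Import boolp classical_sets functions cardinality.
From Stdlib Require Import Relation_Operators Operators_Properties.

Set Implicit Arguments.
Unset Strict Implicit.
Unset Printing Implicit Defensive.

Local Open Scope classical_set_scope.
Local Open Scope card_scope.

(* X `|_|` X' : [Up x] is the vertex x and [Lo x] is the vertex x'. *)
Inductive vertex (X : Type) : Type := Up of X | Lo of X.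

(* A graph is encoded by its adjacency relation; [edge_deg] says that every
   vertex has degree at most 1. *)
Record pbrauer (X : Type) : Type := PBrauer {
  edge : vertex X -> vertex X -> Prop;
  edge_sym : forall u v, edge u v -> edge v u;
  edge_irrefl : forall u, ~ edge u u;
  edge_deg : forall u, is_subset1 (edge u) }.

Lemma pbrauer_ext (X : Type) (a b : pbrauer X) :
  (forall u v, edge a u v <-> edge b u v) -> a = b.
Proof.
case: a => e s i d; case: b => e' s' i' d' /= H.
have E : e = e' by apply/funext => u; apply/funext => v; apply/propext.
by case: _ / E s' i' d' {H} => s' i' d'; congr PBrauer; exact: Prop_irrelevance.
Qed.

(* X `|_|` X' `|_|` X'' : [PUp x], [PLo x], [PMid x] are x, x', x''. *)
Inductive pvertex (X : Type) : Type := PUp of X | PLo of X | PMid of X.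

Definition outer {X : Type} (u : vertex X) : pvertex X :=
  match u with Up x => PUp x | Lo x => PLo x end.

Definition vee {X : Type} (u : vertex X) : pvertex X :=
  match u with Up x => PUp x | Lo x => PMid x end.

Definition wedge {X : Type} (u : vertex X) : pvertex X :=
  match u with Up x => PMid x | Lo x => PLo x end.

Inductive prod_edge {X : Type} (a b : pbrauer X) :
    pvertex X -> pvertex X -> Prop :=
| prod_edge_vee u v of edge a u v : prod_edge a b (vee u) (vee v)
| prod_edge_wedge u v of edge b u v : prod_edge a b (wedge u) (wedge v).

(* [prod_edge a b] is symmetric, so its reflexive transitive closure is the
   relation of lying in the same connected component. *)
Definition connected {X : Type} (a b : pbrauer X) :
  pvertex X -> pvertex X -> Prop := clos_refl_trans _ (prod_edge a b).

Definition mul_edge {X : Type} (a b : pbrauer X) (u v : vertex X) : Prop :=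
  u <> v /\ connected a b (outer u) (outer v).

Lemma prod_edge_sym (X : Type) (a b : pbrauer X) p q :
  prod_edge a b p q -> prod_edge a b q p.
Proof. by case=> u v /edge_sym; constructor. Qed.

Lemma connected_sym (X : Type) (a b : pbrauer X) p q :
  connected a b p q -> connected a b q p.
Proof.
elim=> [x y /prod_edge_sym|x|x y z _ Hyx _ Hzy]; first exact: rt_step.
  exact: rt_refl.
exact: rt_trans Hzy Hyx.
Qed.

(* In a union of two matchings (indexed by bool), a connected component has at
   most two vertices that are isolated in one of the matchings. *)
Section Alternating.
Variables (V : Type) (E : bool -> V -> V -> Prop).
Hypothesis Esym : forall c u v, E c u v -> E c v u.
Hypothesis Efun : forall c u, is_subset1 (E c u).

Let leaf c v := forall w, ~ E (~~ c) v w.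

Fixpoint alt_walk (c : bool) (a : V) (n : nat) (v : V) : Prop :=
  if n is m.+1 then exists2 u, alt_walk c a m u & E (c (+) odd m) u v
  else v = a.

Lemma alt_walk_fun c a n : is_subset1 (alt_walk c a n).
Proof.
elim: n => [|n IH] u v /=; first by move=> -> ->.
by move=> [u' Hu' uu'] [v' /(IH _ _ Hu') <-]; exact: Efun.
Qed.

Lemma alt_walk_reach c a v : leaf c a ->
  clos_refl_trans_n1 _ (fun u v => exists d, E d u v) a v ->
  exists n, alt_walk c a n v.
Proof.
move=> ca; elim=> [|u w [d uw] _ [n Hn]]; first by exists 0.
have [dE|dN] := eqVneq d (c (+) odd n); first by exists n.+1, u => //; rewrite -dE.
have {dN} dE : d = ~~ (c (+) odd n) by case: d (c (+) _) dN {uw} => -[].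
case: n Hn dE => [/= ua|n [u' Hu' u'u]] dE.
  by move: uw; rewrite ua dE addbF => /ca.
exists n; suff -> : w = u' by [].
by move: uw; rewrite dE /= addbN negbK => /Efun; apply; exact: Esym.
Qed.

Lemma alt_walk_end c a d b m k : leaf d b ->
  alt_walk c a m.+1 b -> ~ exists v, alt_walk c a (m.+2 + k) v.
Proof.
move=> db mb; elim: k => [|k IH] [v].
  rewrite addn0 => -[u /(alt_walk_fun mb) <-] bv.
  case: mb => u' _ /Esym bu'.
  have [E1|E1] := eqVneq (c (+) odd m) d.
    by move: bv; rewrite /= addbN E1 => /db.
  have E2 : c (+) odd m = ~~ d by case: d (c (+) _) E1 {db bu'} => -[].
  by move: bu'; rewrite E2 => /db.
by rewrite addnS => -[u /= Hu _]; apply: IH; exists u.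
Qed.

Lemma alternating_ends ca cb cc a b c :
  leaf ca a -> leaf cb b -> leaf cc c -> a <> b -> a <> c ->
  clos_refl_trans _ (fun u v => exists d, E d u v) a b ->
  clos_refl_trans _ (fun u v => exists d, E d u v) a c -> b = c.
Proof.
move=> La Lb Lc ab ac /(@clos_rt_rtn1 _ _ _ _) Rb /(@clos_rt_rtn1 _ _ _ _) Rc.
have [n Hn] := alt_walk_reach La Rb; have [m Hm] := alt_walk_reach La Rc.
case: n Hn => [/esym//|n] Hn; case: m Hm => [/esym//|m] Hm.
have [nm|mn|nm] := ltngtP n m.
- case: (alt_walk_end (k := m - n.+1) Lb Hn); exists c.
  by rewrite addSn subnKC.
- case: (alt_walk_end (k := n - m.+1) Lc Hm); exists b.
  by rewrite addSn subnKC.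
- by move: Hm; rewrite -nm; exact: alt_walk_fun.
Qed.

End Alternating.

Lemma vee_inj (X : Type) : injective (@vee X).
Proof. by move=> [x|x] [y|y] //= [->]. Qed.

Lemma wedge_inj (X : Type) : injective (@wedge X).
Proof. by move=> [x|x] [y|y] //= [->]. Qed.

Lemma outer_inj (X : Type) : injective (@outer X).
Proof. by move=> [x|x] [y|y] //= [->]. Qed.

Section MulDeg.
Variables (X : Type) (a b : pbrauer X).

Let E (c : bool) (p q : pvertex X) : Prop :=
  if c then exists u v, [/\ p = vee u, q = vee v & edge a u v]
  else exists u v, [/\ p = wedge u, q = wedge v & edge b u v].

Let E_sym c p q : E c p q -> E c q p.
Proof. by case: c => -[u [v [-> -> /edge_sym]]]; exists v, u. Qed.

Let E_fun c p : is_subset1 (E c p).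
Proof.
case: c => _ _ [u [v [-> -> uv]]] [u' [v' [uu' -> uv']]].
  by move/vee_inj: uu' uv' => <- /(edge_deg uv) ->.
by move/wedge_inj: uu' uv' => <- /(edge_deg uv) ->.
Qed.

Let outer_leaf u : exists c, forall p, ~ E (~~ c) (outer u) p.
Proof.
case: u => x; first by exists true => p [[y|y] [v []]].
by exists false => p [[y|y] [v []]].
Qed.

Let connectedE p q : connected a b p q ->
  clos_refl_trans _ (fun u v => exists d, E d u v) p q.
Proof.
elim=> [_ _ [] u v uv|x|x y z _ xy _ yz]; last exact: rt_trans xy yz.
- by apply: rt_step; exists true, u, v.
- by apply: rt_step; exists false, u, v.
- exact: rt_refl.
Qed.

Lemma mul_edge_deg u : is_subset1 (mul_edge a b u).
Proof.
move=> v w [uv /connectedE cv] [uw /connectedE cw].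
have [[c Hu] [d Hv] [e Hw]] := And3 (outer_leaf u) (outer_leaf v) (outer_leaf w).
apply: outer_inj.
by apply: (alternating_ends E_sym E_fun Hu Hv Hw) cv cw => /outer_inj.
Qed.

Lemma mul_edge_sym u v : mul_edge a b u v -> mul_edge a b v u.
Proof. by case=> uv /connected_sym; split=> // /esym. Qed.

Lemma mul_edge_irrefl u : ~ mul_edge a b u u.
Proof. by case. Qed.

Definition pbrauer_mul : pbrauer X :=
  PBrauer mul_edge_sym mul_edge_irrefl mul_edge_deg.

End MulDeg.

Definition one_edge {X : Type} (u v : vertex X) : Prop :=
  match u, v with
  | Up x, Lo y | Lo x, Up y => x = y
  | _, _ => False
  end.

Lemma one_edge_sym (X : Type) (u v : vertex X) : one_edge u v -> one_edge v u.
Proof. by case: u v => x [] y /=. Qed.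

Lemma one_edge_irrefl (X : Type) (u : vertex X) : ~ one_edge u u.
Proof. by case: u => x []. Qed.

Lemma one_edge_deg (X : Type) (u : vertex X) : is_subset1 (one_edge u).
Proof. by case: u => x [] y [] z //= <- <-. Qed.

Definition pbrauer_one (X : Type) : pbrauer X :=
  PBrauer (@one_edge_sym X) (@one_edge_irrefl X) (@one_edge_deg X).

Lemma rt_edge (X : Type) (a : pbrauer X) u v :
  clos_refl_trans _ (edge a) u v -> u = v \/ edge a u v.
Proof.
elim=> [x y xy|x|x y z _ xy _ yz]; [by right|by left|].
case: xy yz => [->//|xy] [<-|yz]; first by right.
by left; exact: edge_deg (edge_sym xy) yz.
Qed.

Lemma rt_map (T U : Type) (R : T -> T -> Prop) (S : U -> U -> Prop) (f : T -> U) :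
  (forall x y, R x y -> clos_refl_trans _ S (f x) (f y)) ->
  forall x y, clos_refl_trans _ R x y -> clos_refl_trans _ S (f x) (f y).
Proof.
move=> RS x y; elim=> [|z|u v w _ uv _ vw]; [exact: RS|exact: rt_refl|].
exact: rt_trans uv vw.
Qed.

Section Glue.
Variables (V P P' Q : Type) (S : P -> P -> Prop) (S' : P' -> P' -> Prop).
Variables (R : Q -> Q -> Prop) (i : P' -> Q) (j : P -> Q).
Variables (k : V -> P') (o : V -> P).
Hypothesis i_inj : injective i.
Hypothesis j_inj : injective j.
Hypothesis ij : forall q r, i q = j r -> exists2 w, q = k w & r = o w.
Hypothesis S'R : forall q q', S' q q' -> clos_refl_trans _ R (i q) (i q').
Hypothesis SS' : forall w w',
  clos_refl_trans _ S (o w) (o w') -> clos_refl_trans _ S' (k w) (k w').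
Hypothesis R_SS' : forall x y, R x y ->
  (exists q q', [/\ x = i q, y = i q' & S' q q']) \/
  (exists r r', [/\ x = j r, y = j r' & S r r']).

Lemma glue p q :
  clos_refl_trans _ S' p q <-> clos_refl_trans _ R (i p) (i q).
Proof.
split=> [|/(@clos_rt_rtn1 _ _ _ _) Rpq]; first exact: rt_map.
suff main x : clos_refl_trans_n1 _ R (i p) x ->
    (forall q, i q = x -> clos_refl_trans _ S' p q) /\
    (forall r, x = j r -> exists2 w, clos_refl_trans _ S' p (k w) &
                                     clos_refl_trans _ S (o w) r).
  by have [+ _] := main _ Rpq; apply.
elim=> [|y z /R_SS' yz _ [IH1 IH2]].
  split=> [q0 /i_inj ->|r /ij [w -> ->]]; first exact: rt_refl.
  by exists w; exact: rt_refl.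
case: yz => [[q0 [q' [yq zq' qq']]]|[r [r' [yr zr' rr']]]].
  have pq' : clos_refl_trans _ S' p q'.
    by apply: rt_trans (IH1 _ (esym yq)) _; exact: rt_step.
  split=> [q1|r]; first by rewrite zq' => /i_inj ->.
  by rewrite zq' => /ij [w wE ->]; exists w; [rewrite -wE|exact: rt_refl].
have [w pw wr] := IH2 _ yr.
have wr' : clos_refl_trans _ S (o w) r' by apply: rt_trans wr _; exact: rt_step.
split=> [q0|r1]; last by rewrite zr' => /j_inj <-; exists w.
rewrite zr' => /ij [w' -> r'E]; apply: rt_trans pw _.
by apply: SS'; rewrite -r'E.
Qed.

End Glue.

Section Assoc.
Variables (X : Type) (a b c : pbrauer X).

Inductive qvertex : Type := Q1 of X | Q2 of X | Q3 of X | Q4 of X.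

Let la (u : vertex X) := match u with Up x => Q1 x | Lo x => Q2 x end.
Let lb (u : vertex X) := match u with Up x => Q2 x | Lo x => Q3 x end.
Let lc (u : vertex X) := match u with Up x => Q3 x | Lo x => Q4 x end.

Let R (x y : qvertex) : Prop :=
  [\/ exists u v, [/\ x = la u, y = la v & edge a u v],
      exists u v, [/\ x = lb u, y = lb v & edge b u v] |
      exists u v, [/\ x = lc u, y = lc v & edge c u v]].

Let i12 p := match p with PUp x => Q1 x | PMid x => Q2 x | PLo x => Q3 x end.
Let i13 p := match p with PUp x => Q1 x | PMid x => Q3 x | PLo x => Q4 x end.
Let i14 p := match p with PUp x => Q1 x | PMid x => Q2 x | PLo x => Q4 x end.
Let i24 p := match p with PUp x => Q2 x | PMid x => Q3 x | PLo x => Q4 x end.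

Let connected_mul (d e : pbrauer X) (f : vertex X -> pvertex X)
    (S : pvertex X -> pvertex X -> Prop) :
  (forall u v, edge (pbrauer_mul d e) u v -> S (f u) (f v)) ->
  forall u v, connected d e (outer u) (outer v) ->
  clos_refl_trans _ S (f u) (f v).
Proof.
move=> H u v uv; have [<-|uv'] := pselect (u = v); first exact: rt_refl.
by apply: rt_step; exact: H.
Qed.

Lemma mulA_edgel u v : edge (pbrauer_mul (pbrauer_mul a b) c) u v <->
  u <> v /\ clos_refl_trans _ R (i13 (outer u)) (i13 (outer v)).
Proof.
rewrite /= /mul_edge; suff -> : forall p q, connected (pbrauer_mul a b) c p q <->
  clos_refl_trans _ R (i13 p) (i13 q) by [].
apply: (@glue _ _ _ _ (prod_edge a b) _ R i13 i12 vee outer).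
- by move=> [x|x|x] [y|y|y] //= [->].
- by move=> [x|x|x] [y|y|y] //= [->].
- by move=> [x|x|x] [y|y|y] //= [->]; [exists (Up y)|exists (Lo y)].
- move=> _ _ [u0 v0 [_]|u0 v0 uv].
    have E w : i13 (vee w) = i12 (outer w) by case: w.
    rewrite !E; apply: rt_map => _ _ [] u1 v1 uv1; apply: rt_step.
      by apply: Or31; exists u1, v1; split=> //; [case: (u1)|case: (v1)].
    by apply: Or32; exists u1, v1; split=> //; [case: (u1)|case: (v1)].
  apply: rt_step; apply: Or33; exists u0, v0.
  by split=> //; [case: (u0)|case: (v0)].
- by apply: connected_mul => u0 v0; exact: prod_edge_vee.
- move=> x y [] [u0 [v0 [-> -> uv]]].
  + right; exists (vee u0), (vee v0).
    by split; [case: (u0)|case: (v0)|exact: prod_edge_vee].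
  + right; exists (wedge u0), (wedge v0).
    by split; [case: (u0)|case: (v0)|exact: prod_edge_wedge].
  + left; exists (wedge u0), (wedge v0).
    by split; [case: (u0)|case: (v0)|exact: prod_edge_wedge].
Qed.

Lemma mulA_edger u v : edge (pbrauer_mul a (pbrauer_mul b c)) u v <->
  u <> v /\ clos_refl_trans _ R (i14 (outer u)) (i14 (outer v)).
Proof.
rewrite /= /mul_edge; suff -> : forall p q, connected a (pbrauer_mul b c) p q <->
  clos_refl_trans _ R (i14 p) (i14 q) by [].
apply: (@glue _ _ _ _ (prod_edge b c) _ R i14 i24 wedge outer).
- by move=> [x|x|x] [y|y|y] //= [->].
- by move=> [x|x|x] [y|y|y] //= [->].
- by move=> [x|x|x] [y|y|y] //= [->]; [exists (Lo y)|exists (Up y)].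
- move=> _ _ [u0 v0 uv|u0 v0 [_]].
    apply: rt_step; apply: Or31; exists u0, v0.
    by split=> //; [case: (u0)|case: (v0)].
  have E w : i14 (wedge w) = i24 (outer w) by case: w.
  rewrite !E; apply: rt_map => _ _ [] u1 v1 uv1; apply: rt_step.
    by apply: Or32; exists u1, v1; split=> //; [case: (u1)|case: (v1)].
  by apply: Or33; exists u1, v1; split=> //; [case: (u1)|case: (v1)].
- by apply: connected_mul => u0 v0; exact: prod_edge_wedge.
- move=> x y [] [u0 [v0 [-> -> uv]]].
  + left; exists (vee u0), (vee v0).
    by split; [case: (u0)|case: (v0)|exact: prod_edge_vee].
  + right; exists (vee u0), (vee v0).
    by split; [case: (u0)|case: (v0)|exact: prod_edge_vee].
  + right; exists (wedge u0), (wedge v0).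
    by split; [case: (u0)|case: (v0)|exact: prod_edge_wedge].
Qed.

Lemma pbrauer_mulA :
  pbrauer_mul a (pbrauer_mul b c) = pbrauer_mul (pbrauer_mul a b) c.
Proof.
apply: pbrauer_ext => u v; rewrite mulA_edgel mulA_edger.
have E w : i13 (outer w) = i14 (outer w) by case: w.
by rewrite !E.
Qed.

End Assoc.

Lemma pbrauer_mul1 (X : Type) : left_id (pbrauer_one X) (@pbrauer_mul X).
Proof.
move=> a; apply: pbrauer_ext => u v; split=> [[uv]|uv].
  pose f (p : pvertex X) := match p with PUp x | PMid x => Up x | PLo x => Lo x end.
  have fE w : f (outer w) = w by case: w.
  move=> cuv; suff : clos_refl_trans _ (edge a) (f (outer u)) (f (outer v)).
    by rewrite !fE => /rt_edge [].
  apply: rt_map cuv => _ _ [] [x|x] [y|y] //= xy.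
  1,2: by rewrite xy; exact: rt_refl.
  1-4: exact: rt_step.
split=> [uv'|]; first by move: uv; rewrite uv' => /edge_irrefl.
have out w : connected (pbrauer_one X) a (outer w) (wedge w).
  case: w => x; last exact: rt_refl.
  by apply: rt_step; exact: (@prod_edge_vee _ (pbrauer_one X) a (Up x) (Lo x)).
apply: rt_trans (out u) _; apply: rt_trans _ (connected_sym (out v)).
by apply: rt_step; exact: prod_edge_wedge.
Qed.

Lemma pbrauer_mulr1 (X : Type) : right_id (pbrauer_one X) (@pbrauer_mul X).
Proof.
move=> a; apply: pbrauer_ext => u v; split=> [[uv]|uv].
  pose f (p : pvertex X) := match p with PLo x | PMid x => Lo x | PUp x => Up x end.
  have fE w : f (outer w) = w by case: w.
  move=> cuv; suff : clos_refl_trans _ (edge a) (f (outer u)) (f (outer v)).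
    by rewrite !fE => /rt_edge [].
  apply: rt_map cuv => _ _ [] [x|x] [y|y] //= xy.
  5,6: by rewrite xy; exact: rt_refl.
  1-4: exact: rt_step.
split=> [uv'|]; first by move: uv; rewrite uv' => /edge_irrefl.
have out w : connected a (pbrauer_one X) (outer w) (vee w).
  case: w => x; first exact: rt_refl.
  by apply: rt_step; exact: (@prod_edge_wedge _ a (pbrauer_one X) (Lo x) (Up x)).
apply: rt_trans (out u) _; apply: rt_trans _ (connected_sym (out v)).
by apply: rt_step; exact: prod_edge_vee.
Qed.

HB.instance Definition _ (X : Type) := gen_eqMixin (pbrauer X).
HB.instance Definition _ (X : Type) := gen_choiceMixin (pbrauer X).
HB.instance Definition _ (X : Type) := isMonoid.Build (pbrauer X)
  (@pbrauer_mulA X) (@pbrauer_mul1 X) (@pbrauer_mulr1 X).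

Definition Dom {X : Type} (a : pbrauer X) : set X :=
  [set x | exists y, edge a (Up x) (Lo y)].

Definition Codom {X : Type} (a : pbrauer X) : set X :=
  [set y | exists x, edge a (Up x) (Lo y)].

(* There is no type of cardinal numbers: def(a) = codef(a) is the equipotence
   [#=] of the two complements. *)
Definition def_eq_codef {X : Type} (a : pbrauer X) : Prop :=
  ~` Dom a #= ~` Codom a.

Definition idempotents (M : semigroupType) : set M := [set e | (e * e)%g = e].

Definition units (M : monoidType) : set M :=
  [set g | exists h, (g * h = 1 /\ h * g = 1)%g].

Definition subsemigroup (M : semigroupType) (A : set M) : Prop :=
  forall x y, A x -> A y -> A (x * y)%g.

Definition generated (M : semigroupType) (A : set M) : set M :=
  smallest (@subsemigroup M) A.

Definition mulset (M : semigroupType) (A B : set M) : set M :=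
  [set (x * y)%g | x in A & y in B].

Arguments idempotents M : clear implicits.
Arguments units M : clear implicits.

Definition E_PB (X : Type) : set (pbrauer X) := idempotents (pbrauer X).
Arguments E_PB X : clear implicits.

Definition G_PB (X : Type) : set (pbrauer X) := units (pbrauer X).
Arguments G_PB X : clear implicits.

Definition F_PB (X : Type) : set (pbrauer X) := generated (E_PB X `|` G_PB X).
Arguments F_PB X : clear implicits.

(* Main.v *)
Require Import Defs.
From mathcomp Require Import all_boot.
From mathcomp Require Import boolp classical_sets functions cardinality.
From Stdlib Require Import Relation_Operators Operators_Properties.

Set Implicit Arguments.
Unset Strict Implicit.
Unset Printing Implicit Defensive.

Local Open Scope classical_set_scope.
Local Open Scope card_scope.

(** Write def(a) and codef(a) for the sizes of the complements of [Dom a] and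
    [Codom a].

    A graph with def = codef is an idempotent times a unit: its transversals
    form a bijection from [Dom a] onto [Codom a], and equipotence of the
    complements extends that bijection to a permutation [f] of [X]
    ([transversal_permutation]).  Undoing [f] on either side of [a] makes every
    transversal vertical, and such a graph is idempotent
    ([vertical_idempotent]): in its square the vertical edges compose to
    themselves, and hooks are never prolonged.

    Conversely, def = codef holds for idempotents and units and is preserved by
    products.  No cardinal arithmetic is needed, even for infinite [X], thanks
    to one fact about the middle row of an arbitrary product [a * b]
    ([middle_compl_card]).  Each transversal of [a * b] enters the middle row
    along a transversal of [a] and leaves it along a transversal of [b]; let [S]
    and [T] be the sets of all entrance and of all exit points.  A point in both
    [S] and [T] is the entrance and the exit of one and the same transversal,
    so following the transversals matches [S `\` T] with [T `\` S], whence the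
    complements of [S] and [T] are equipotent.
    - If [a = b = e] is idempotent, then [S = Codom e] and [T = Dom e].
    - If def(a) = codef(a), a permutation that extends the transversals of [a]
      carries the complement of [Dom (a * b)] onto that of [S]; likewise for
      [b], [T] and [Codom (a * b)]. *)

(** * Equipotence and gluing of bijections *)

(** Bijections are handled as relations, since the transversals of a graph come
    as a relation; gluing two of them is then a disjunction, and no default
    value is needed when the type is empty. *)
Definition bij_rel {T : Type} (A B : set T) (R : T -> T -> Prop) : Prop :=
  [/\ forall x y, R x y -> A x /\ B y,
      forall x, A x -> exists y, R x y,
      forall y, B y -> exists x, R x y,
      forall x y y', R x y -> R x y' -> y = y' &
      forall x x' y, R x y -> R x' y -> x = x'].

Lemma bij_rel_fun (T : Type) (A B : set T) (R : T -> T -> Prop) :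
  bij_rel A B R -> exists2 f, set_bij A B f & forall x, A x -> R x (f x).
Proof.
case=> sub tot sur fun_ inj.
have [x|f Rf] := choice (P := fun x y => A x -> R x y).
  by have [/tot[y]|] := pselect (A x); [exists y|exists x].
exists f => //; split.
- by move=> x /Rf /sub[].
- by move=> x y /set_mem/Rf xf /set_mem/Rf yf fxy; apply: inj xf _; rewrite fxy.
- move=> y /sur[x xy]; have [Ax _] := sub _ _ xy.
  by exists x => //; exact: fun_ (Rf _ Ax) xy.
Qed.

Lemma bij_rel_card (T : Type) (A B : set T) (R : T -> T -> Prop) :
  bij_rel A B R -> A #= B.
Proof. by case/bij_rel_fun => f /Pbij[g _] _; exact: pcard_eq. Qed.

Lemma card_bij_rel (T : Type) (A B : set T) :
  A #= B -> exists R, bij_rel A B R.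
Proof.
move=> /card_bijP[f [g fK gK]].
exists (fun x y => exists2 a, x = set_val a & y = set_val (f a)); split.
- by move=> _ _ [a -> ->]; split; exact: set_valP.
- move=> x Ax; exists (set_val (f (SigSub (mem_set Ax)))).
  by exists (SigSub (mem_set Ax)).
- move=> y By; exists (set_val (g (SigSub (mem_set By)))).
  by exists (g (SigSub (mem_set By))); rewrite ?gK.
- by move=> _ _ _ [a -> ->] [a' /val_inj <- ->].
- by move=> _ _ _ [a -> ->] [a' -> /val_inj/(can_inj fK) ->].
Qed.

Lemma bij_relU (T : Type) (A A' B B' : set T) (R R' : T -> T -> Prop) :
  A `&` A' `<=` set0 -> B `&` B' `<=` set0 ->
  bij_rel A B R -> bij_rel A' B' R' ->
  bij_rel (A `|` A') (B `|` B') (fun x y => R x y \/ R' x y).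
Proof.
move=> AA' BB' [s t u f i] [s' t' u' f' i']; split.
- by move=> x y [/s[Ax By]|/s'[Ax By]]; split; [left|left|right|right].
- by move=> x [/t[y]|/t'[y]]; exists y; [left|right].
- by move=> y [/u[x]|/u'[x]]; exists x; [left|right].
- move=> x y y' [xy|xy] [xy'|xy']; [exact: f xy xy'| | |exact: f' xy xy'].
    by case: (AA' x); split; [case: (s _ _ xy)|case: (s' _ _ xy')].
  by case: (AA' x); split; [case: (s _ _ xy')|case: (s' _ _ xy)].
- move=> x x' y [xy|xy] [xy'|xy']; [exact: i xy xy'| | |exact: i' xy xy'].
    by case: (BB' y); split; [case: (s _ _ xy)|case: (s' _ _ xy')].
  by case: (BB' y); split; [case: (s _ _ xy')|case: (s' _ _ xy)].
Qed.

Lemma card_eq_setU (T : Type) (A A' B B' : set T) :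
  A `&` A' `<=` set0 -> B `&` B' `<=` set0 ->
  A #= B -> A' #= B' -> A `|` A' #= B `|` B'.
Proof.
move=> AA' BB' /card_bij_rel[R HR] /card_bij_rel[R' HR'].
exact: bij_rel_card (bij_relU AA' BB' HR HR').
Qed.

(** The complements of [S] and [T] share the complement of [S `|` T]; what is
    left over is [T `\` S] on one side and [S `\` T] on the other. *)
Lemma card_eq_setC (X : Type) (S T : set X) :
  S `\` T #= T `\` S -> ~` S #= ~` T.
Proof.
move=> ST.
have splitC (A B : set X) : ~` A = ~` (A `|` B) `|` (B `\` A).
  apply/seteqP; split=> [x Ax|x [AB Ax|[]//]]; last by apply: AB; left.
  have [Bx|Bx] := pselect (B x); first by right.
  by left; case.
have disj (A B : set X) : ~` (A `|` B) `&` (B `\` A) `<=` set0.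
  by move=> x [AB [Bx _]]; apply: AB; right.
rewrite (splitC S T) (splitC T S).
apply: card_eq_setU; [exact: disj|exact: disj| |].
- by rewrite setUC.
- by rewrite card_eq_sym.
Qed.

Lemma card_eq_inj (T : Type) (A B : set T) (f g : T -> T) :
  cancel f g -> cancel g f -> (forall x, A x <-> B (f x)) -> A #= B.
Proof.
move=> fK gK AB; have -> : B = f @` A.
  apply/seteqP; split=> [y By|_ [x Ax <-]]; last exact/AB.
  by exists (g y); rewrite ?gK// AB gK.
by rewrite card_eq_sym; apply: inj_card_eq; exact: in2W (can_inj fK).
Qed.

(** * Edges of a product *)

Section ProductEdges.
Context {X : Type}.
Implicit Types (a b e : pbrauer X) (x y p q : X) (u v : vertex X).

Lemma mul_upper_hook a b x y :
  edge a (Up x) (Up y) -> edge (a * b)%g (Up x) (Up y).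
Proof.
move=> xy; split; last by apply: rt_step; exact: prod_edge_vee xy.
by move=> E; move: xy; rewrite E => /edge_irrefl.
Qed.

Lemma mul_lower_hook a b x y :
  edge b (Lo x) (Lo y) -> edge (a * b)%g (Lo x) (Lo y).
Proof.
move=> xy; split; last by apply: rt_step; exact: prod_edge_wedge xy.
by move=> E; move: xy; rewrite E => /edge_irrefl.
Qed.

Lemma mul_transversal a b p x q : edge a (Up p) (Lo x) ->
  edge b (Up x) (Lo q) -> edge (a * b)%g (Up p) (Lo q).
Proof.
move=> px xq; split=> //; apply: (@rt_trans _ _ _ (PMid x)); apply: rt_step.
  exact: prod_edge_vee px.
exact: prod_edge_wedge xq.
Qed.

(** A path that leaves a vertex of the upper row starts along an edge of the
    first factor, since only that factor meets the upper row. *)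
Lemma mul_edge_Up a b x v :
  edge (a * b)%g (Up x) v -> exists w, edge a (Up x) w.
Proof.
case=> xv /(@clos_rt_rt1n _ _ _ _) H; inversion H as [E|q r xq _].
  by case: xv; apply: outer_inj.
move: xq; move Ep: (outer _) => z xq.
by case: xq Ep => [[y|y] w yw|[y|y] w yw] //= [->]; exists w.
Qed.

Lemma mul_edge_Lo a b x v :
  edge (a * b)%g (Lo x) v -> exists w, edge b (Lo x) w.
Proof.
case=> xv /(@clos_rt_rt1n _ _ _ _) H; inversion H as [E|q r xq _].
  by case: xv; apply: outer_inj.
move: xq; move Ep: (outer _) => z xq.
by case: xq Ep => [[y|y] w yw|[y|y] w yw] //= [->]; exists w.
Qed.

(** If the first edge were a hook of [a], it would be a hook of [a * b] too, and
    the upper vertex would have degree two there. *)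
Lemma mul_transversal_Dom a b p q : edge (a * b)%g (Up p) (Lo q) -> Dom a p.
Proof.
move=> pq; have [[x|x] px] := mul_edge_Up pq; last by exists x.
by have := edge_deg pq (mul_upper_hook b px).
Qed.

Lemma mul_transversal_Codom a b p q :
  edge (a * b)%g (Up p) (Lo q) -> Codom b q.
Proof.
move=> /edge_sym pq; have [[x|x] px] := mul_edge_Lo pq.
  by exists x; exact: edge_sym.
by have := edge_deg pq (mul_lower_hook a px).
Qed.

(** An inclusion of edge sets is an equality as soon as the smaller graph already
    saturates every vertex that the larger one does. *)
Lemma edge_sub_eq a b : (forall u v, edge a u v -> edge b u v) ->
  (forall u v, edge b u v -> exists w, edge a u w) -> a = b.
Proof.
move=> ab ba; apply: pbrauer_ext => u v; split=> [|uv]; first exact: ab.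
by have [w uw] := ba _ _ uv; rewrite (edge_deg uv (ab _ _ uw)).
Qed.

(** Hooks survive in the square, and a vertical edge at [x] composes with itself
    through the middle copy of [x]; so the square contains [e].  It joins no
    vertex that [e] leaves isolated, hence it contains nothing else. *)
Lemma vertical_idempotent e :
  (forall x y, edge e (Up x) (Lo y) -> x = y) -> E_PB X e.
Proof.
move=> vert; apply/esym/edge_sub_eq => [[x|x] [y|y] xy|[x|x] v].
- exact: mul_upper_hook.
- move: (xy) => /vert E; move: xy; rewrite -E => xx.
  exact: (mul_transversal xx xx).
- move/edge_sym: xy => xy; move: (xy) => /vert E; move: xy; rewrite -E => xx.
  by apply: edge_sym; exact: (mul_transversal xx xx).
- exact: mul_lower_hook.
- exact: mul_edge_Up.
- exact: mul_edge_Lo.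
Qed.

End ProductEdges.

(** * Units *)

Section Permutations.
Context {X : Type}.
Implicit Types (f g : X -> X).

Definition perm_edge f (u v : vertex X) : Prop :=
  match u, v with
  | Up x, Lo y | Lo y, Up x => y = f x
  | _, _ => False
  end.

Lemma perm_edge_sym f u v : perm_edge f u v -> perm_edge f v u.
Proof. by case: u v => x [] y. Qed.

Lemma perm_edge_irrefl f u : ~ perm_edge f u u.
Proof. by case: u => x []. Qed.

Lemma perm_edge_deg f : injective f -> forall u, is_subset1 (perm_edge f u).
Proof. by move=> fI [] x [] y [] z //= -> => [->|/fI ->]. Qed.

Definition perm_graph f (f_inj : injective f) : pbrauer X :=
  PBrauer (@perm_edge_sym f) (@perm_edge_irrefl f) (perm_edge_deg f_inj).

Lemma perm_graphV f g (fK : cancel f g) (gK : cancel g f) :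
  (perm_graph (can_inj fK) * perm_graph (can_inj gK) = 1)%g.
Proof.
have vert x : edge (perm_graph (can_inj fK) * perm_graph (can_inj gK))%g
                (Up x) (Lo x).
  by apply: (@mul_transversal _ _ _ _ (f x)) => //=; rewrite fK.
apply/esym/edge_sub_eq => [[x|x] [y|y] //= ->|[x|x] v _].
- exact: vert.
- exact: (edge_sym (vert y)).
- by exists (Lo x).
- by exists (Up x).
Qed.

Lemma perm_graph_unit f g (fK : cancel f g) (gK : cancel g f) :
  G_PB X (perm_graph (can_inj fK)).
Proof. by exists (perm_graph (can_inj gK)); rewrite !perm_graphV. Qed.

End Permutations.

(** * Defect and codefect *)

Section Defect.
Context {X : Type}.
Implicit Types (a b e : pbrauer X).

Lemma transversal_bij_rel a :
  bij_rel (Dom a) (Codom a) (fun x y => edge a (Up x) (Lo y)).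
Proof.
split=> // [x y xy|x y y' xy xy'|x x' y /edge_sym xy /edge_sym xy'].
- by split; [exists y|exists x].
- by case: (edge_deg xy xy').
- by case: (edge_deg xy xy').
Qed.

Lemma transversal_permutation a : def_eq_codef a ->
  exists f g, [/\ cancel f g, cancel g f &
    forall x y, edge a (Up x) (Lo y) -> y = f x].
Proof.
move=> /card_bij_rel[R HR].
have disj (A : set X) : A `&` ~` A `<=` set0 by move=> x [].
have := bij_relU (disj _) (disj _) (transversal_bij_rel a) HR.
rewrite !setUv => H; have [_ _ _ fR _] := H.
have [f + Rf] := bij_rel_fun H; rewrite setTT_bijective => -[g fK gK].
by exists f, g; split=> // x y xy; apply: fR (Rf x I); left.
Qed.

Lemma unit_def_eq_codef g : G_PB X g -> def_eq_codef g.
Proof.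
case=> h [gh hg]; rewrite /def_eq_codef.
have -> : Dom g = setT.
  apply/seteqP; split=> // x _.
  by apply: (@mul_transversal_Dom _ _ h x x); rewrite gh.
have -> : Codom g = setT; last exact: card_eqxx.
apply/seteqP; split=> // x _.
by apply: (@mul_transversal_Codom _ h _ x x); rewrite hg.
Qed.

Definition entrance a b : set X :=
  [set x | exists2 p, Dom (a * b)%g p & edge a (Up p) (Lo x)].

Definition exit a b : set X :=
  [set y | exists2 q, Codom (a * b)%g q & edge b (Up y) (Lo q)].

(** Equipotence of [entrance a b] and [exit a b] themselves would say nothing
    about their complements when they are infinite; the matching along the
    transversals of the product is therefore restricted to the two set
    differences. *)
Lemma middle_compl_card a b : ~` entrance a b #= ~` exit a b.
Proof.
apply: card_eq_setC.
apply: (@bij_rel_card _ _ _ (fun x y => [/\ ~ exit a b x, ~ entrance a b y &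
  exists p q, [/\ edge a (Up p) (Lo x), edge (a * b)%g (Up p) (Lo q) &
    edge b (Up y) (Lo q)]])).
split.
- move=> x y [xT yS [p [q [px pq yq]]]]; split; split=> //.
    by exists p => //; exists q.
  by exists q => //; exists p.
- move=> x [[p [q pq] px] xT]; have [y yq] := mul_transversal_Codom pq.
  exists y; split=> //; last by exists p, q.
  (* Were [y] an entrance as well, the transversal entering at [y] would leave
     there at once and so end at [q]: it is the one entering at [x], and
     [x = y]. *)
  move=> [p' _ p'y]; apply: xT.
  have [pp'] := edge_deg (edge_sym pq) (edge_sym (mul_transversal p'y yq)).
  rewrite -pp' in p'y; case: (edge_deg px p'y) => ->.
  by exists q => //; exists p.
- move=> y [[q [p pq] yq] yS]; have [x px] := mul_transversal_Dom pq.
  exists x; split=> //; last by exists p, q.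
  move=> [q' _ xq']; apply: yS.
  have [qq'] := edge_deg pq (mul_transversal px xq').
  rewrite -qq' in xq'; case: (edge_deg (edge_sym yq) (edge_sym xq')) => ->.
  by exists p => //; exists q.
- move=> x y y' [_ _ [p [q [px pq yq]]]] [_ _ [p' [q' [px' pq' yq']]]].
  have [pp'] := edge_deg (edge_sym px) (edge_sym px'); rewrite -pp' in pq'.
  have [qq'] := edge_deg pq pq'; rewrite -qq' in yq'.
  by have [] := edge_deg (edge_sym yq) (edge_sym yq').
- move=> x x' y [_ _ [p [q [px pq yq]]]] [_ _ [p' [q' [px' pq' yq']]]].
  have [qq'] := edge_deg yq yq'; rewrite -qq' in pq'.
  have [pp'] := edge_deg (edge_sym pq) (edge_sym pq'); rewrite -pp' in px'.
  by have [] := edge_deg px px'.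
Qed.

(** In [e * e = e] every transversal of [e] enters the middle row, and every one
    leaves it. *)
Lemma idempotent_def_eq_codef e : E_PB X e -> def_eq_codef e.
Proof.
move=> ee; rewrite /def_eq_codef card_eq_sym.
suff [<- <-] : entrance e e = Codom e /\ exit e e = Dom e.
  exact: middle_compl_card.
rewrite /entrance /exit ee; split; apply/seteqP; split=> x.
- by move=> [p _ px]; exists p.
- by move=> [p px]; exists p => //; exists x.
- by move=> [q _ xq]; exists q.
- by move=> [q xq]; exists q => //; exists x.
Qed.

(** Only the complements of [entrance a b] and [exit a b] are controlled by
    [middle_compl_card]; extending the transversals of [a] and [b] to
    permutations is what transports them to the outer rows. *)
Lemma def_eq_codef_mul a b :
  def_eq_codef a -> def_eq_codef b -> def_eq_codef (a * b)%g.
Proof.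
move=> /transversal_permutation[f [f' [fK f'K af]]].
move=> /transversal_permutation[g [g' [gK g'K bg]]].
have DS : ~` Dom (a * b)%g #= ~` entrance a b.
  apply: (card_eq_inj fK f'K) => p; apply: not_iff_compat; split=> [pD|].
    have [q pq] := pD; have [x px] := mul_transversal_Dom pq.
    by exists p => //; rewrite -(af _ _ px).
  by move=> [p' p'D p'p]; rewrite (can_inj fK (af _ _ p'p)).
have TC : ~` exit a b #= ~` Codom (a * b)%g.
  apply: (card_eq_inj gK g'K) => y; apply: not_iff_compat; split=> [|yC].
    by move=> [q qC yq]; rewrite -(bg _ _ yq).
  exists (g y) => //; have [p pgy] := yC.
  by have [y' y'q] := mul_transversal_Codom pgy; rewrite {1}(can_inj gK (bg _ _ y'q)).
exact: card_eq_trans (card_eq_trans DS (middle_compl_card a b)) TC.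
Qed.

(** * Factorisations into an idempotent and a unit *)

Lemma def_eq_codef_EG a : def_eq_codef a -> mulset (E_PB X) (G_PB X) a.
Proof.
move=> /transversal_permutation[f [g [fK gK af]]].
exists (a * perm_graph (can_inj gK))%g; last first.
  exists (perm_graph (can_inj fK)); first exact: perm_graph_unit gK.
  by rewrite -mulgA perm_graphV mulg1.
apply: vertical_idempotent => x z xz; have [y xy] := mul_transversal_Dom xz.
have xgy : edge (a * perm_graph (can_inj gK))%g (Up x) (Lo (g y)).
  exact: mul_transversal xy _.
have [->] := edge_deg xz xgy.
by rewrite (af _ _ xy) fK.
Qed.

Lemma def_eq_codef_GE a : def_eq_codef a -> mulset (G_PB X) (E_PB X) a.
Proof.
move=> /transversal_permutation[f [g [fK gK af]]].
exists (perm_graph (can_inj fK)); first exact: perm_graph_unit gK.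
exists (perm_graph (can_inj gK) * a)%g; last by rewrite mulgA perm_graphV mul1g.
apply: vertical_idempotent => x z xz; have [y yz] := mul_transversal_Codom xz.
have fyz : edge (perm_graph (can_inj gK) * a)%g (Up (f y)) (Lo z).
  by apply: mul_transversal _ yz => /=; rewrite fK.
have [->] := edge_deg (edge_sym xz) (edge_sym fyz).
by rewrite (af _ _ yz).
Qed.

End Defect.

Theorem theorem6p1 (X : Type) :
  [/\ F_PB X = mulset (E_PB X) (G_PB X),
      mulset (E_PB X) (G_PB X) = mulset (G_PB X) (E_PB X) &
      mulset (G_PB X) (E_PB X) = [set a : pbrauer X | def_eq_codef a]].
Proof.
have EG : mulset (E_PB X) (G_PB X) = [set a : pbrauer X | def_eq_codef a].
  apply/seteqP; split=> [_ [e Ee [g Gg <-]]|a]; last exact: def_eq_codef_EG.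
  apply: def_eq_codef_mul; first exact: idempotent_def_eq_codef.
  exact: unit_def_eq_codef.
have GE : mulset (G_PB X) (E_PB X) = [set a : pbrauer X | def_eq_codef a].
  apply/seteqP; split=> [_ [g Gg [e Ee <-]]|a]; last exact: def_eq_codef_GE.
  apply: def_eq_codef_mul; first exact: unit_def_eq_codef.
  exact: idempotent_def_eq_codef.
split; [|by rewrite EG GE|exact: GE].
apply/seteqP; split=> [a|_ [e Ee [g Gg <-]] M [subM EGM]].
  apply; rewrite EG; split; first exact: def_eq_codef_mul.
  by move=> b [/idempotent_def_eq_codef|/unit_def_eq_codef].
by apply: subM; apply: EGM; [left|right].
Qed.
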